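(* Let $K\subseteq\mathbf{R}^n$ be a nonempty unbounded closed set and let $f_1:\mathbf{R}^n\to\mathbf{R}$ be a polynomial of degree $d_1\ge1$. The following statements are equivalent: (i) $f_1$ is bounded from below on $K$, and there exist $\bar x\in K$ and a closed set $S\subseteq\mathbf{R}^n$ with $(K_{\bar x})_\infty\subseteq S_\infty\subseteq K_\infty$ such that $f_1$ is relatively regular with $S$ on $K$, i.e. $SOL(S_\infty,(f_1)^\infty_{d_1})$ is bounded; (ii) $SOL(K,f_1)$ is nonempty and bounded.
   Context: $K_{\bar x}=\{x\in K: f_1(x)\le f_1(\bar x)\}$. The asymptotic cone of a nonempty set $S$ is $S_\infty=\{v:\exists\, t_k\to+\infty,\ x_k\in S \text{ with } x_k/t_k\to v\}$. For a polynomial $p$ of degree $d$, $p^\infty_d(x)=\lim_{t\to+\infty}p(tx)/t^d$. $SOL(A,p)$ is the set of global minimizers of $p$ over $A$; the empty set counts as bounded. *)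

(* Defs.v *)
(* Mathematical Components with MathComp-Analysis.  The notations
   of the polynomial library clash with those of MathComp-Analysis, so they are
   not imported: mpoly n R is {mpoly R[n]} and meval v p is p.@[v]. *)
From HB Require Import structures.
From mathcomp Require Import all_boot all_order all_algebra.
From mathcomp Require Import -(notations) mpoly.
From mathcomp Require Import all_classical all_reals all_analysis.
Set Implicit Arguments.
Unset Strict Implicit.
Unset Printing Implicit Defensive.
Import Order.TTheory GRing.Theory Num.Theory.
Import numFieldNormedType.Exports.
Local Open Scope classical_set_scope.
Local Open Scope ring_scope.

(* R^n is 'rV[R]_n with the sup norm; boundedness, closedness and convergence
   do not depend on the choice of norm. *)

Definition peval (R : realType) (n : nat) (p : mpoly n R)
    (x : 'rV[R]_n) : R :=
  meval (fun i => x ord0 i) p.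

(* msize is one more than the total degree of a nonzero polynomial, and 0
   for the zero polynomial. *)
Definition has_degree (R : realType) (n : nat) (p : mpoly n R)
    (d : nat) : Prop :=
  msize p = d.+1.

(* Finitely many t k may vanish, where (t k)^-1 = 0; the limit ignores them. *)
Definition asymptotic_cone (R : realType) (n : nat) (S : set 'rV[R]_n) :
    set 'rV[R]_n :=
  [set v | exists (t : nat -> R) (x : nat -> 'rV[R]_n),
     [/\ t k @[k --> \oo] --> +oo,
         forall k, S (x k) &
         (t k)^-1 *: x k @[k --> \oo] --> v]].

(* The limit exists whenever d is at least the degree of p. *)
Definition asymptotic_poly (R : realType) (n d : nat) (p : mpoly n R)
    (x : 'rV[R]_n) : R :=
  lim (peval p (t *: x) / t ^+ d @[t --> +oo]).

Definition SOL (R : realType) (n : nat) (A : set 'rV[R]_n)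
    (f : 'rV[R]_n -> R) : set 'rV[R]_n :=
  [set x | A x /\ forall y, A y -> f x <= f y].

Definition sublevel (R : realType) (n : nat) (K : set 'rV[R]_n)
    (f : 'rV[R]_n -> R) (xbar : 'rV[R]_n) : set 'rV[R]_n :=
  [set x | K x /\ f x <= f xbar].

Definition relatively_regular (R : realType) (n d : nat)
    (p : mpoly n R) (S : set 'rV[R]_n) : Prop :=
  bounded_set (SOL (asymptotic_cone S) (asymptotic_poly d p)).

(* Main.v *)
Require Import Defs.
From HB Require Import structures.
From mathcomp Require Import all_boot all_order all_algebra.
From mathcomp Require Import -(notations) mpoly.
From mathcomp Require Import all_classical all_reals all_analysis.
Set Implicit Arguments.
Unset Strict Implicit.
Unset Printing Implicit Defensive.
Import Order.TTheory GRing.Theory Num.Theory.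
Import numFieldNormedType.Exports.
Local Open Scope classical_set_scope.
Local Open Scope ring_scope.

(** Both directions compare the sublevel set of [f1] at a point of [K] with its
    directions at infinity.

    From the regularity condition to minimizers: a polynomial of degree [d]
    that is bounded on a set has, after division by [t ^ d], a limit of known
    sign along every asymptotic direction of the set. The limit is the value of
    the leading form, the homogeneous part of degree [d], at that direction
    ([cvg_asymptotic_poly]). Hence the leading form is nonnegative on the
    asymptotic cone of [K], where [f1] is bounded below, and nonpositive on
    that of the sublevel set, where [f1] is bounded above
    ([asymptotic_poly_ge0], [asymptotic_poly_le0]). So each asymptotic
    direction of the sublevel set minimizes the leading form over the
    asymptotic cone of [S]. These directions form a cone, so if one of them is
    nonzero then the set of minimizers is unbounded, against regularity. A set
    whose only asymptotic direction is [0] is bounded ([asymptotic_cone_neq0]);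
    the sublevel set is therefore compact ([bounded_sublevel]) and [f1] attains
    its minimum on it, which is its minimum on [K] ([SOL_of_bounded_sublevel]).

    Conversely, the sublevel set at a minimizer is the set of all minimizers.
    It is bounded, so its asymptotic cone is [{0}], and the singleton [{0}] can
    be taken for [S]. *)

(** * Limits of polynomials *)

Lemma cvgryV0 (R : realType) (T : Type) (F : set_system T) {FF : Filter F}
    (t : T -> R) :
  t k @[k --> F] --> +oo -> (t k)^-1 @[k --> F] --> 0.
Proof.
move=> ty; apply/gtr0_cvgV0 => //; exact: (cvgry_gt ty 0).
Qed.

Lemma cvg_monomial (R : realType) (n : nat) (T : Type) (F : set_system T)
    {FF : Filter F} (y : T -> 'rV[R]_n) (v : 'rV[R]_n) (m : multinom n) :
  y k @[k --> F] --> v ->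
  \prod_i y k ord0 i ^+ m i @[k --> F] --> \prod_i v ord0 i ^+ m i.
Proof.
move=> yv; apply: cvg_big => [|i _]; first exact: mul_continuous.
have yiv : y k ord0 i @[k --> F] --> v ord0 i.
  apply: (cvg_comp y (fun M : 'rV[R]_n => M ord0 i) yv).
  exact: coord_continuous.
apply: (cvg_comp (fun k => y k ord0 i) (fun z : R => z ^+ m i) yiv).
exact: exprn_continuous.
Qed.

Lemma cvg_peval (R : realType) (n : nat) (p : mpoly n R) (T : Type)
    (F : set_system T) {FF : Filter F} (y : T -> 'rV[R]_n) (v : 'rV[R]_n) :
  y k @[k --> F] --> v -> peval p (y k) @[k --> F] --> peval p v.
Proof.
move=> yv; rewrite /peval mevalE; under eq_fun do rewrite mevalE.
apply: cvg_big => [|m _]; first exact: add_continuous.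
by apply: cvgM; [exact: cvg_cst|exact: cvg_monomial].
Qed.

Lemma continuous_peval (R : realType) (n : nat) (p : mpoly n R) :
  continuous (peval p).
Proof. by move=> v; exact: (@cvg_peval R n p _ (nbhs v) _ id v). Qed.

(** In the variables [y] and [t^-1] the rescaled polynomial is again a
    polynomial, since every exponent [d - mdeg m] is a true difference; this
    makes its limit for [t] tending to [+oo] a matter of continuity at
    [t^-1 = 0]. *)
Lemma peval_rescale (R : realType) (n d : nat) (p : mpoly n R)
    (hp : (msize p <= d.+1)%N) (t : R) (y : 'rV[R]_n) : t != 0 ->
  peval p (t *: y) / t ^+ d =
  \sum_(m <- msupp p)
    mcoeff m p * \prod_i y ord0 i ^+ m i * t^-1 ^+ (d - mdeg m).
Proof.
move=> t0; rewrite /peval mevalE mulr_suml big_seq [RHS]big_seq.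
apply: eq_bigr => m /msize_mdeg_lt /leq_trans/(_ hp); rewrite ltnS => md.
rewrite -!mulrA; congr (_ * _).
under eq_bigr do rewrite mxE exprMn.
rewrite big_split/= prodrXr -mdegE mulrAC mulrC; congr (_ * _).
by rewrite -{1}(subnK md) exprD invfM mulrCA divff ?expf_neq0 ?mulr1// exprVn.
Qed.

(** The definition of [asymptotic_poly] follows the ray through a fixed [v],
    while an asymptotic direction is only approached by moving points [y k];
    the joint continuity of [peval_rescale] in [t^-1] and [y] gives the same
    limit for both. *)
Lemma cvg_asymptotic_poly (R : realType) (n d : nat) (p : mpoly n R)
    (hp : (msize p <= d.+1)%N) (T : Type) (F : set_system T)
    {FF : ProperFilter F} (t : T -> R) (y : T -> 'rV[R]_n) (v : 'rV[R]_n) :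
  t k @[k --> F] --> +oo -> y k @[k --> F] --> v ->
  peval p (t k *: y k) / t k ^+ d @[k --> F] --> asymptotic_poly d p v.
Proof.
(* The factor 0 ^+ (d - mdeg m) is 1 for mdeg m = d and 0 otherwise, so that L
   is the value at v of the homogeneous part of degree d. *)
pose L := \sum_(m <- msupp p)
  mcoeff m p * \prod_i v ord0 i ^+ m i * 0 ^+ (d - mdeg m).
have joint T' (G : set_system T') (s : T' -> R) (z : T' -> 'rV[R]_n) :
    ProperFilter G -> s k @[k --> G] --> +oo -> z k @[k --> G] --> v ->
    peval p (s k *: z k) / s k ^+ d @[k --> G] --> L.
  move=> PG sy zv.
  have s0 : \forall k \near G, s k != 0.
    by apply: filterS (cvgry_gt sy 0) => k; exact: lt0r_neq0.
  apply: cvg_trans.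
    apply: near_eq_cvg; near=> k; symmetry; apply: peval_rescale => //.
    by near: k.
  apply: cvg_big => [|m _]; first exact: add_continuous.
  apply: cvgM.
    by apply: cvgM; [exact: cvg_cst|exact: cvg_monomial].
  apply: (cvg_comp (fun k => (s k)^-1) (fun x : R => x ^+ (d - mdeg m))).
    exact: cvgryV0.
  exact: exprn_continuous.
suff -> : asymptotic_poly d p v = L by exact: joint.
apply: cvg_lim => //; apply: joint; [exact: cvg_id|exact: cvg_cst].
Unshelve. all: by end_near. Qed.

Lemma cvg_asymptotic_cone (R : realType) (n d : nat) (p : mpoly n R)
    (hp : (msize p <= d.+1)%N) (t : nat -> R) (x : nat -> 'rV[R]_n)
    (v : 'rV[R]_n) :
  t k @[k --> \oo] --> +oo -> (t k)^-1 *: x k @[k --> \oo] --> v ->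
  peval p (x k) / t k ^+ d @[k --> \oo] --> asymptotic_poly d p v.
Proof.
move=> ty xv; apply: cvg_trans (cvg_asymptotic_poly hp ty xv).
apply: near_eq_cvg; near=> k.
rewrite scalerA divff ?scale1r//; apply: lt0r_neq0.
near: k; exact: (cvgry_gt ty 0).
Unshelve. all: by end_near. Qed.

Lemma cvg_const_div (R : realType) (d : nat) (t : nat -> R) (c : R) :
  (0 < d)%N -> t k @[k --> \oo] --> +oo -> c / t k ^+ d @[k --> \oo] --> 0.
Proof.
move=> d0 ty; rewrite -(mulr0 c); apply: cvgM; first exact: cvg_cst.
under eq_fun do rewrite -exprVn.
have <- : (0 : R) ^+ d = 0 by rewrite expr0n; case: d d0.
apply: (cvg_comp (fun k => (t k)^-1) (fun x : R => x ^+ d)).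
  exact: cvgryV0.
exact: exprn_continuous.
Qed.

(** * The sign of the leading form on an asymptotic cone *)

(** The bound [c] disappears in the limit because [c / t ^ d] tends to [0];
    here the degree has to be positive. *)
Lemma asymptotic_poly_ge0 (R : realType) (n d : nat) (p : mpoly n R)
    (hp : (msize p <= d.+1)%N) (d0 : (0 < d)%N) (S : set 'rV[R]_n) (c : R) :
  (forall x, S x -> c <= peval p x) ->
  forall v, asymptotic_cone S v -> 0 <= asymptotic_poly d p v.
Proof.
move=> Sc v [t [x [ty Sx xv]]].
apply: (ler_cvg_to (cvg_const_div c d0 ty) (cvg_asymptotic_cone hp ty xv)).
apply: filterS (cvgry_gt ty 0) => k tk; apply: ler_wpM2r; last exact: Sc.
by rewrite invr_ge0 exprn_ge0// ltW.
Qed.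

Lemma asymptotic_poly_le0 (R : realType) (n d : nat) (p : mpoly n R)
    (hp : (msize p <= d.+1)%N) (d0 : (0 < d)%N) (S : set 'rV[R]_n) (c : R) :
  (forall x, S x -> peval p x <= c) ->
  forall v, asymptotic_cone S v -> asymptotic_poly d p v <= 0.
Proof.
move=> Sc v [t [x [ty Sx xv]]].
apply: (ler_cvg_to (cvg_asymptotic_cone hp ty xv) (cvg_const_div c d0 ty)).
apply: filterS (cvgry_gt ty 0) => k tk; apply: ler_wpM2r; last exact: Sc.
by rewrite invr_ge0 exprn_ge0// ltW.
Qed.

(** * Asymptotic cones *)

Lemma bounded_setP (R : realType) (n : nat) (A : set 'rV[R]_n) :
  bounded_set A <-> exists M : R, forall x, A x -> `|x| <= M.
Proof.
split=> [|[M AM]]; last first.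
  exists M; split; first exact: num_real.
  move=> N MN x /AM /le_trans; apply; exact: ltW.
move=> [M [_ AM]]; exists (M + 1); apply: AM.
by rewrite ltrDl.
Qed.

Lemma asymptotic_cone0 (R : realType) (n : nat) (S : set 'rV[R]_n) :
  S !=set0 -> asymptotic_cone S 0.
Proof.
move=> [a Sa]; exists (fun k => k%:R), (fun=> a); split=> //.
  exact: cvgr_idn.
rewrite -(scale0r a); apply: cvgZ; last exact: cvg_cst.
by apply: cvgryV0; exact: cvgr_idn.
Qed.

Lemma asymptotic_coneZ (R : realType) (n : nat) (S : set 'rV[R]_n) (c : R)
    (v : 'rV[R]_n) :
  0 < c -> asymptotic_cone S v -> asymptotic_cone S (c *: v).
Proof.
move=> c0 [t [x [ty Sx xv]]]; exists (fun k => c^-1 * t k), x; split=> //.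
  apply/cvgryPge => A; apply: filterS (cvgry_ge ty (c * A)) => k.
  by rewrite ler_pdivlMl.
under eq_fun do rewrite invfM invrK -scalerA.
by apply: cvgZ => //; exact: cvg_cst.
Qed.

Lemma bounded_asymptotic_cone (R : realType) (n : nat) (S : set 'rV[R]_n) :
  bounded_set S -> asymptotic_cone S `<=` [set 0].
Proof.
move=> /bounded_setP[M SM] v [t [x [ty Sx xv]]] /=.
apply/eqP; rewrite -normr_le0.
have tM : (t k)^-1 * M @[k --> \oo] --> 0.
  by rewrite -(mul0r M); apply: cvgM; [exact: cvgryV0|exact: cvg_cst].
apply: (ler_cvg_to (cvg_norm xv) tM).
apply: filterS (cvgry_gt ty 0) => k tk.
have tk0 : 0 <= (t k)^-1 by rewrite invr_ge0 ltW.
by rewrite normrZ ger0_norm//; apply: ler_wpM2l => //; exact: SM.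
Qed.

(** Normalize points of [S] whose norms tend to infinity.  The unit sphere is
    compact, so the normalized points have a cluster point, which has norm 1
    and is the limit of a subsequence. *)
Lemma asymptotic_cone_neq0 (R : realType) (n : nat) (S : set 'rV[R]_n) :
  ~ bounded_set S -> exists2 v, asymptotic_cone S v & v != 0.
Proof.
move=> Sunb.
have /choice[x xP] (k : nat) : exists x, S x /\ k%:R < `|x|.
  apply: contrapT => noS; apply: Sunb; apply/bounded_setP; exists k%:R => x Sx.
  by rewrite leNgt; apply/negP => kx; apply: noS; exists x.
have x0 k : 0 < `|x k| by apply: le_lt_trans (xP k).2.
pose y k := `|x k|^-1 *: x k.
have y1 k : `|y k| = 1.
  by rewrite normrZ ger0_norm ?invr_ge0// mulVf// lt0r_neq0.
pose A := [set z : 'rV[R]_n | `|z| = 1].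
have Acl : closed A.
  apply: (@preimage_closed _ _ (fun z : 'rV[R]_n => `|z|) [set 1]).
    by move=> z _; exact: norm_continuous.
  exact: closed_eq.
have Abnd : bounded_set A by apply/bounded_setP; exists 1 => z ->.
have [] := @bounded_closed_compact R n A Abnd Acl (y @ \oo).
  by exists 0%N => // k _; exact: y1.
move=> v [v1 vy].
(* The indices i j need not increase: j <= i j is enough for the norms of the
   x (i j) to tend to infinity. *)
have /choice[i iP] (j : nat) : exists k, (j <= k)%N /\ `|v - y k| < j.+1%:R^-1.
  have [] := vy [set z | exists2 k, (j <= k)%N & z = y k] (ball v j.+1%:R^-1).
  - by exists j => // k /= jk; exists k.
  - by apply: nbhsx_ballx; rewrite invr_gt0.
  by move=> z [[k jk ->]]; rewrite -ball_normE; exists k.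
exists v; last by rewrite -normr_gt0 v1.
exists (fun j => `|x (i j)|), (fun j => x (i j)); split.
- apply/cvgryPge => B; apply: filterS (cvgry_ge (@cvgr_idn R) B) => j /le_trans.
  apply; apply: le_trans (ltW (xP (i j)).2).
  by rewrite ler_nat (iP j).1.
- by move=> k; exact: (xP _).1.
apply/cvgrPdist_lt => e e0.
near=> j; apply: lt_trans (iP j).2 _.
by near: j; exact: (near_infty_natSinv_lt (PosNum e0)).
Unshelve. all: by end_near. Qed.

(** * Sublevel sets and minimizers *)

(** A minimum over the sublevel set is a minimum over [K], since [f] exceeds
    [f xbar] outside of the sublevel set. *)
Lemma SOL_of_bounded_sublevel (R : realType) (n : nat) (K : set 'rV[R]_n)
    (f : 'rV[R]_n -> R) (xbar : 'rV[R]_n) :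
  closed K -> continuous f -> K xbar -> bounded_set (sublevel K f xbar) ->
  SOL K f !=set0 /\ bounded_set (SOL K f).
Proof.
move=> Kcl fC Kx Lbnd.
have Lcl : closed (sublevel K f xbar).
  apply: closedI => //; apply: (@preimage_closed _ _ f [set r | r <= f xbar]).
    by move=> z _; exact: fC.
  exact: closed_le.
have Lx : sublevel K f xbar xbar by split=> //=.
split.
  have [|||c cL cmin] := @EVT_min_rV R n f (sublevel K f xbar).
  - by exists xbar.
  - exact: bounded_closed_compact.
  - exact: continuous_subspaceT.
  move: cL; rewrite inE => -[Kc fc]; exists c; split=> // y Ky.
  have [fy|/ltW] := leP (f y) (f xbar); last exact: le_trans.
  by apply: cmin; rewrite inE; split.
move/bounded_setP: Lbnd => [M LM]; apply/bounded_setP; exists M => x [Kx' xmin].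
by apply: LM; split=> //=; exact: xmin.
Qed.

(** An unbounded sublevel set would have a nonzero asymptotic direction [v];
    all its positive multiples would then minimize the leading form over the
    asymptotic cone of [S], and regularity bounds their norms. *)
Lemma bounded_sublevel (R : realType) (n d : nat) (p : mpoly n R)
    (hp : (msize p <= d.+1)%N) (d0 : (0 < d)%N)
    (K S : set 'rV[R]_n) (xbar : 'rV[R]_n) :
  has_lbound (peval p @` K) ->
  asymptotic_cone (sublevel K (peval p) xbar) `<=` asymptotic_cone S ->
  asymptotic_cone S `<=` asymptotic_cone K ->
  relatively_regular d p S ->
  bounded_set (sublevel K (peval p) xbar).
Proof.
move=> [c cK] LS SK /bounded_setP[M SM]; apply: contrapT.
move=> /asymptotic_cone_neq0[v Lv v0].
have p_ge0 w : asymptotic_cone S w -> 0 <= asymptotic_poly d p w.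
  move=> /SK; apply: (asymptotic_poly_ge0 hp d0 (c := c)) => x Kx.
  by apply: cK; exists x.
have solL w : asymptotic_cone (sublevel K (peval p) xbar) w ->
    SOL (asymptotic_cone S) (asymptotic_poly d p) w.
  move=> Lw; split=> [|u /p_ge0]; first exact: LS.
  by apply: le_trans; apply: asymptotic_poly_le0 Lw => // x [_ xx]; exact: xx.
have vpos : 0 < `|v| by rewrite normr_gt0.
have Mpos : 0 < `|M| + 1 by rewrite ltr_wpDl.
(* This multiple of v has norm |M| + 1, beyond the bound M. *)
have /SM : SOL (asymptotic_cone S) (asymptotic_poly d p)
    ((`|M| + 1) / `|v| *: v).
  by apply/solL/asymptotic_coneZ => //; rewrite divr_gt0.
rewrite normrZ normrM normfV normr_id divfK ?lt0r_neq0// (gtr0_norm Mpos).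
by rewrite leNgt (le_lt_trans (ler_norm M))// ltrDl.
Qed.

Theorem corollary16 (R : realType) (n : nat) (K : set 'rV[R]_n)
    (f1 : mpoly n R) (d1 : nat)
    (hK0 : K !=set0) (hKunb : ~ bounded_set K) (hKcl : closed K)
    (hd1 : (1 <= d1)%N) (hf1 : has_degree f1 d1) :
  (has_lbound (peval f1 @` K) /\
   exists xbar : 'rV[R]_n, K xbar /\
   exists S : set 'rV[R]_n,
     [/\ closed S,
         asymptotic_cone (sublevel K (peval f1) xbar) `<=` asymptotic_cone S,
         asymptotic_cone S `<=` asymptotic_cone K &
         relatively_regular d1 f1 S])
  <->
  (SOL K (peval f1) !=set0 /\ bounded_set (SOL K (peval f1))).
Proof.
have hp : (msize f1 <= d1.+1)%N by rewrite hf1.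
split=> [[lb [xbar [Kx [S [Scl LS SK reg]]]]]|[[x [Kx xmin]] bnd]].
  apply: (SOL_of_bounded_sublevel hKcl (@continuous_peval R n f1) Kx).
  exact: bounded_sublevel reg.
split; first by exists (peval f1 x) => _ [y Ky <-]; exact: xmin.
exists x; split=> //; exists [set 0].
have cone0 : asymptotic_cone (R := R) (n := n) [set 0] `<=` [set 0].
  apply/bounded_asymptotic_cone/bounded_setP; exists 0 => _ ->.
  by rewrite normr0.
split.
- apply: accessible_closed_set1.
  exact: hausdorff_accessible (@norm_hausdorff _ _).
- move=> v Lv; suff -> : v = 0 by apply: asymptotic_cone0; exists 0.
  apply: bounded_asymptotic_cone Lv.
  have -> // : sublevel K (peval f1) x = SOL K (peval f1).
  apply/seteqP; split=> z [Kz].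
    by move=> zx; split=> // y /xmin; exact: le_trans.
  by move=> zmin; split=> //; exact: zmin.
- by move=> v /cone0 ->; exact: asymptotic_cone0.
- by apply/bounded_setP; exists 0 => v [/cone0 -> _]; rewrite normr0.
Qed.
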